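(* Let $R$ be a Rota--Baxter operator of weight $0$ on $M_3(\mathbb{C})$ satisfying $(R(1))^2\neq 0$. Then, up to conjugation with the transpose and with an automorphism of $M_3(\mathbb{C})$ and up to a nonzero scalar multiple, $R$ coincides with the linear operator $O$ on $M_3(\mathbb{C})$ defined by $$O(e_{13})=O(e_{23})=O(e_{33})=0,\quad O(e_{12})=e_{13},\quad O(e_{11})=e_{12}+e_{23},\quad O(e_{22})=e_{23},$$ $$O(e_{21})=-e_{11},\quad O(e_{32})=-(e_{11}+e_{22}),\quad O(e_{31})=-e_{21}.$$
   Context: A Rota--Baxter operator of weight $0$ on an associative algebra $A$ over $\mathbb{C}$ is a linear map $R\colon A\to A$ such that $R(x)R(y)=R(R(x)y+xR(y))$ for all $x,y\in A$. $M_3(\mathbb{C})$ is the algebra of $3\times3$ complex matrices, $e_{ij}$ are the matrix units, and $1$ is the identity matrix. For an automorphism or antiautomorphism $\psi$ of $M_3(\mathbb{C})$ (for example, the transpose), conjugation of $R$ with $\psi$ means passing to $\psi^{-1}R\psi$. *)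

(* Defs.v *)
(* The field of complex numbers is K[i] for K : realType. *)
From HB Require Import structures.
From mathcomp Require Import all_boot all_order all_algebra.
From mathcomp Require Import reals.
From mathcomp Require Export complex.
Set Implicit Arguments.
Unset Strict Implicit.
Unset Printing Implicit Defensive.
Import Order.TTheory GRing.Theory Num.Theory.
Local Open Scope ring_scope.

Definition rota_baxter0 (F : comNzRingType) (A : algType F)
    (R : {linear A -> A}) : Prop :=
  forall x y : A, R x * R y = R (R x * y + x * R y).

(* psi^-1 R psi; [psi'] is meant to be the two-sided inverse of [psi], which is
   required explicitly at the place of use. *)
Definition conjugate (T : Type) (psi psi' R : T -> T) : T -> T :=
  fun x => psi' (R (psi x)).

Section OperatorO.
Variable F : comNzRingType.

(* Matrix units with indices ranging over 1, 2, 3. *)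
Definition e (i j : nat) : 'M[F]_3 := delta_mx (inord i.-1) (inord j.-1).

Definition O_unit (i j : nat) : 'M[F]_3 :=
  match i, j with
  | 1%N, 2%N => e 1 3
  | 1%N, 1%N => e 1 2 + e 2 3
  | 2%N, 2%N => e 2 3
  | 2%N, 1%N => - e 1 1
  | 3%N, 2%N => - (e 1 1 + e 2 2)
  | 3%N, 1%N => - e 2 1
  | _, _ => 0
  end.

Definition O (x : 'M[F]_3) : 'M[F]_3 :=
  \sum_(i < 3) \sum_(j < 3) x i j *: O_unit i.+1 j.+1.

Fact O_is_linear : linear O.
Proof.
move=> a x y; rewrite /O scaler_sumr -big_split; apply: eq_bigr => i _.
rewrite scaler_sumr -big_split; apply: eq_bigr => j _.
by rewrite !mxE scalerDl scalerA.
Qed.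

HB.instance Definition _ :=
  GRing.isLinear.Build F 'M[F]_3 'M[F]_3 *:%R O O_is_linear.

Lemma O_e (i j : nat) : (0 < i <= 3)%N -> (0 < j <= 3)%N ->
  O (e i j) = O_unit i j.
Proof.
case: i => // i; case: j => // j /= lti ltj.
rewrite /O (bigD1 (inord i)) //= [X in _ + X]big1 ?addr0 => [|k kNi].
  rewrite (bigD1 (inord j)) //= [X in _ + X]big1 ?addr0 => [|k kNj].
    by rewrite mxE !eqxx scale1r !inordK.
  by rewrite mxE (negPf kNj) andbF scale0r.
by rewrite big1 // => l _; rewrite mxE (negPf kNi) scale0r.
Qed.

Lemma O_values :
  [/\ O (e 1 3) = 0, O (e 2 3) = 0 & O (e 3 3) = 0] /\
  [/\ O (e 1 2) = e 1 3, O (e 1 1) = e 1 2 + e 2 3 & O (e 2 2) = e 2 3] /\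
  [/\ O (e 2 1) = - e 1 1, O (e 3 2) = - (e 1 1 + e 2 2)
    & O (e 3 1) = - e 2 1].
Proof. by rewrite !O_e. Qed.

End OperatorO.

(* Main.v *)
Require Import Defs.
From HB Require Import structures.
From mathcomp Require Import all_boot all_order all_algebra.
From mathcomp Require Import boolp reals ring.
Set Implicit Arguments.
Unset Strict Implicit.
Unset Printing Implicit Defensive.
Import Order.TTheory GRing.Theory Num.Theory.
Local Open Scope ring_scope.

(** Everything is read off from r = R 1. Putting 1 for one argument of the
Rota-Baxter identity gives

    r * R x = R (r * x) + R (R x),      R x * r = R (x * r) + R (R x),

so the image of R is stable under multiplication by r on both sides and R
commutes with the commutator [r, -].

Applied to powers of r these identities read R (p'(r)) = p(r) - p(0). An
idempotent polynomial in r without constant term is then a value of R at an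
element commuting with it, and the identity forces it to vanish; hence r is
nilpotent [R1_nilpotent]. For 3 x 3 matrices with r^2 != 0 it is a single
Jordan block, so after conjugation r equals O 1 = e12 + 2 e23, called N below
[regular_nilpotent_conj]. Since the block can be rescaled by conjugation, the
scalar multiple in the theorem can always be taken to be 1.

The operator is then pinned down by looking at the image of R.
- The identity matrix is not in the image, since R z = 1 would give 1 = 2.
  This kills the (3,1) entry of every b in the image: N^2 b + N b N + b N^2
  commutes with N, so it is a polynomial in N, and its constant term is a
  multiple of that entry [image_31].
- The (3,1) entry of a product b b' of two values is now b_32 b'_21, so one of
  the entries (3,2) and (2,1) vanishes on the whole image [image_32_or_21].
  The two cases are exchanged by an antiautomorphism fixing N, which is where
  the transpose in the theorem comes from. Assume that it is (3,2).
- The image is not upper triangular: otherwise R sends the diagonal units into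
  the line of e13, contradicting R 1 = N [image_not_upper].
- The (3,3) entry is then a multiplicative functional on the image which turns
  out to be zero, so the image has zero last row [image_33]; it follows that R
  kills the last column [R_col3].

The remaining values of R solve linear equations involving [N, -], up to a few
constants which the quadratic identity determines, except for one
[R_values]. That last parameter is the coordinate along the conjugations by
1 + a e13, which fix N, and such a conjugation removes it [normal_form]. *)

(** * Rota-Baxter operators and the element R 1 *)

Section Powers.
Variables (F : numFieldType) (A : algType F) (R : {linear A -> A}).
Hypothesis R_RB : rota_baxter0 R.
Let r := R 1.

Lemma R1_mul x : r * R x = R (r * x) + R (R x).
Proof. by rewrite R_RB mul1r linearD. Qed.

Lemma mul_R1 x : R x * r = R (x * r) + R (R x).
Proof. by rewrite R_RB mulr1 addrC linearD. Qed.

(** R acts on the powers of R 1 as integration from 0. *)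
Lemma R_pow_R1 k : R (r ^+ k *+ k.+1) = r ^+ k.+1.
Proof.
elim: k => [|k IHk]; first by rewrite expr0 mulr1n expr1.
by rewrite [RHS]exprS -IHk R1_mul IHk mulrnAr -exprS -linearD -mulrSr.
Qed.

(** From R z = 1 the identity would give 1 = R (2 z) = 2. *)
Lemma one_notin_image z : R z != 1.
Proof.
apply/eqP => Rz1; have := R_RB z z.
rewrite Rz1 !mul1r !mulr1 linearD Rz1 => /eqP.
by rewrite -subr_eq subrr eq_sym oner_eq0.
Qed.

End Powers.

Lemma rota_baxter0_transport (F : comNzRingType) (A : algType F)
    (R f g : {linear A -> A}) :
  cancel f g -> cancel g f ->
  {morph f : x y / x * y} \/ {morph f : x y / x * y >-> y * x} ->
  rota_baxter0 R -> rota_baxter0 (f \o R \o g).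
Proof.
move=> fK gK fM R_RB x y /=; case: fM => fM.
  rewrite -fM R_RB; congr (f (R _)).
  rewrite -[in X in _ = g X](gK y) -[in X in _ = g X](gK x).
  by rewrite !fK -!fM -linearD fK.
rewrite -fM R_RB; congr (f (R _)).
rewrite -[in X in _ = g X](gK y) -[in X in _ = g X](gK x).
by rewrite !fK -!fM -linearD fK addrC.
Qed.

Definition inner (A : pzRingType) (P Q x : A) := P * x * Q.

Section InnerLinear.
Variables (F : comNzRingType) (A : algType F) (P Q : A).
Fact inner_is_linear : linear (inner P Q).
Proof.
by move=> a x y; rewrite /inner mulrDr mulrDl -scalerAr -scalerAl.
Qed.
HB.instance Definition _ :=
  GRing.isLinear.Build F A A *:%R (inner P Q) inner_is_linear.
End InnerLinear.

Lemma innerK (A : pzRingType) (P Q : A) : Q * P = 1 ->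
  cancel (inner P Q) (inner Q P).
Proof. by move=> QP x; rewrite /inner -!mulrA QP mulr1 mulrA QP mul1r. Qed.

Lemma innerM (A : pzRingType) (P Q : A) : Q * P = 1 ->
  {morph inner P Q : x y / x * y}.
Proof. by move=> QP x y; rewrite /inner !mulrA -[P * x * Q * P]mulrA QP mulr1. Qed.

(** * Nilpotency of R 1 *)

Section Nilpotent.
Variables (F : numFieldType) (n : nat).
Variable (R : {linear 'M[F]_n.+1 -> 'M[F]_n.+1}).
Hypothesis R_RB : rota_baxter0 R.
Let r := R 1.

Lemma R_horner_deriv p : R (horner_mx r p^`()) = horner_mx r p - (p.[0])%:M.
Proof.
rewrite -[p in LHS]coefK -[p in RHS]coefK poly_def.
rewrite horner_sum !raddf_sum /= -big_split /=.
apply: eq_bigr => i _; rewrite derivZ !linearZ /= derivXn hornerZ hornerXn.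
rewrite rmorphMn /= !rmorphXn /= !horner_mx_X.
case: (nat_of_ord i) => [|k].
  by rewrite mulr0n linear0 scaler0 expr0 mulr1 -scalemx1 subrr.
by rewrite R_pow_R1 // expr0n /= mulr0 (raddf0 (@scalar_mx F n.+1)) subr0.
Qed.

(** The idempotent g = w(r) is R z with z = w'(r) commuting with g. Then
g = g^2 = R (2 g z), and squaring this new expression gives
g = R (2 (2 g z)) = 2 g. *)
Lemma idempotent_R1 w : w.[0] = 0 ->
  horner_mx r w * horner_mx r w = horner_mx r w -> horner_mx r w = 0.
Proof.
move=> w0 ww; set z := horner_mx r w^`(); set g := horner_mx r w in ww *.
have Rz : R z = g by rewrite R_horner_deriv w0 (raddf0 (@scalar_mx F n.+1)) subr0.
have gz : z * g = g * z by rewrite -!rmorphM /= mulrC.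
have Rgz : R (g * z *+ 2) = g.
  by rewrite -[RHS]ww -Rz R_RB Rz gz -mulr2n.
have : R (g * z *+ 2) *+ 2 = g.
  rewrite -[RHS]ww -[in RHS]Rgz R_RB Rgz.
  by rewrite mulrnAr mulrnAl -mulrA gz mulrA ww -mulr2n linearMn Rgz.
by rewrite Rgz mulr2n => /eqP; rewrite -subr_eq0 addrK => /eqP.
Qed.

(** If the characteristic polynomial is q X^m with q(0) != 0, a Bezout relation
u q + v X^(m+1) = 1 makes v(r) r^(m+1) the projection onto the invertible part
of r; it is an idempotent without constant term, hence zero. *)
Lemma R1_nilpotent : r ^+ n.+1 = 0.
Proof.
have [m [q q0 Ep]] := multiplicity_XsubC (char_poly r) 0.
rewrite monic_neq0 ?char_poly_monic //= in q0.
(* The exponent is m + 1 so that the idempotent has no constant term even if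
   m = 0. *)
have cop : coprimep q ('X^(m.+1)).
  by rewrite -['X]subr0 -(raddf0 (@polyC F)) coprimep_expr // coprimep_XsubC.
have [[u v] /= uv1] := Bezout_eq1_coprimepP _ _ cop.
have CH : horner_mx r (q * 'X^m) = 0.
  by rewrite -['X]subr0 -(raddf0 (@polyC F)) -Ep Cayley_Hamilton.
have e0 : horner_mx r (v * 'X^(m.+1)) = 0.
  apply: idempotent_R1; first by rewrite hornerM hornerXn expr0n /= mulr0.
  apply/eqP; rewrite -subr_eq0 -rmorphM -rmorphB /=.
  have -> : v * 'X^(m.+1) * (v * 'X^(m.+1)) - v * 'X^(m.+1)
     = - (v * u * 'X * (q * 'X^m)).
    have -> : v * u * 'X * (q * 'X^m) = v * 'X^(m.+1) * (u * q).
      by rewrite exprS; ring.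
    by rewrite -[u * q](addrK (v * 'X^(m.+1))) uv1; ring.
  by rewrite rmorphN rmorphM /= CH mulr0 oppr0.
have rm : r ^+ m = 0.
  have -> : r ^+ m = horner_mx r 'X^m by rewrite rmorphXn /= horner_mx_X.
  have -> : 'X^m = u * (q * 'X^m) + v * 'X^(m.+1) * 'X^m.
    by rewrite mulrA -mulrDl uv1 mul1r.
  by rewrite rmorphD (rmorphM _ u) (rmorphM _ (v * _)) /= CH e0 mulr0 mul0r addr0.
have le_mn : (m <= n.+1)%N.
  have := congr1 (size \o polyseq) Ep; rewrite /= size_char_poly subr0.
  have qN0 : q != 0 by apply: contraNneq q0 => ->; rewrite root0.
  rewrite size_Mmonic ?monicXn // size_polyXn addnS /= => sz.
  by rewrite -ltnS sz -[m in leqLHS]add0n ltn_add2r lt0n size_poly_eq0.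
have -> : r ^+ n.+1 = r ^+ (n.+1 - m) * r ^+ m by rewrite -exprD subnK.
by rewrite rm mulr0.
Qed.
End Nilpotent.

(** * Computing with the entries of 3 x 3 matrices *)

Section Entries.
Variable F : numFieldType.
Implicit Types (A B : 'M[F]_3) (i j k l : nat).

(** Indices run over 1, 2, 3, as for the matrix units. *)
Definition ent A i j : F := A (inord i.-1) (inord j.-1).

Lemma ord3P (P : 'I_3 -> Prop) :
  P (inord 0) -> P (inord 1) -> P (inord 2) -> forall m : 'I_3, P m.
Proof.
move=> P0 P1 P2 [[|[|[|//]]] lt_i];
  [move: P0 | move: P1 | move: P2]; congr P; apply: val_inj; exact: inordK.
Qed.

Lemma sum3 (V : nmodType) (f : 'I_3 -> V) :
  \sum_i f i = f (inord 0) + f (inord 1) + f (inord 2).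
Proof.
rewrite !big_ord_recr big_ord0 /= add0r; congr (f _ + f _ + f _);
  by apply: val_inj; rewrite /= inordK.
Qed.

Lemma ent_ext A B :
  [/\ ent A 1 1 = ent B 1 1, ent A 1 2 = ent B 1 2 & ent A 1 3 = ent B 1 3] ->
  [/\ ent A 2 1 = ent B 2 1, ent A 2 2 = ent B 2 2 & ent A 2 3 = ent B 2 3] ->
  [/\ ent A 3 1 = ent B 3 1, ent A 3 2 = ent B 3 2 & ent A 3 3 = ent B 3 3] ->
  A = B.
Proof.
by move=> [? ? ?] [? ? ?] [? ? ?]; apply/matrixP; do 2!elim/ord3P.
Qed.

Lemma entD A B i j : ent (A + B) i j = ent A i j + ent B i j.
Proof. by rewrite /ent mxE. Qed.

Lemma entN A i j : ent (- A) i j = - ent A i j.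
Proof. by rewrite /ent mxE. Qed.

Lemma entZ a A i j : ent (a *: A) i j = a * ent A i j.
Proof. by rewrite /ent mxE. Qed.

Lemma ent0 i j : ent 0 i j = 0.
Proof. by rewrite /ent mxE. Qed.

Lemma entM A B i j :
  ent (A * B) i j =
  ent A i 1 * ent B 1 j + ent A i 2 * ent B 2 j + ent A i 3 * ent B 3 j.
Proof. by rewrite /ent mxE sum3. Qed.

Lemma inord3_eq i j : (0 < i <= 3)%N -> (0 < j <= 3)%N ->
  (inord i.-1 == inord j.-1 :> 'I_3) = (i == j).
Proof.
case: i j => [|i] [|j] //= lti ltj.
by rewrite -val_eqE /= !inordK.
Qed.

Lemma ent_e k l i j :
  (0 < k <= 3)%N -> (0 < l <= 3)%N -> (0 < i <= 3)%N -> (0 < j <= 3)%N ->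
  ent (e F k l) i j = ((i == k) && (j == l))%:R.
Proof. by move=> *; rewrite /ent mxE !inord3_eq. Qed.

Lemma ent1 i j : (0 < i <= 3)%N -> (0 < j <= 3)%N -> ent 1 i j = (i == j)%:R.
Proof. by move=> *; rewrite /ent mxE inord3_eq. Qed.

Definition entE := (entD, entN, entZ, ent0, entM, ent1, ent_e).

Lemma sum_e A :
  A = (ent A 1 1 *: e F 1 1 + ent A 1 2 *: e F 1 2 + ent A 1 3 *: e F 1 3)
    + (ent A 2 1 *: e F 2 1 + ent A 2 2 *: e F 2 2 + ent A 2 3 *: e F 2 3)
    + (ent A 3 1 *: e F 3 1 + ent A 3 2 *: e F 3 2 + ent A 3 3 *: e F 3 3).
Proof. by apply: ent_ext; split; rewrite !entE //=; ring. Qed.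

Lemma mul_e A k l : (0 < k <= 3)%N -> (0 < l <= 3)%N ->
  A * e F k l = ent A 1 k *: e F 1 l + ent A 2 k *: e F 2 l + ent A 3 k *: e F 3 l.
Proof.
move: k l => [|[|[|[|//]]]] [|[|[|[|//]]]] // _ _;
  by apply: ent_ext; split; rewrite !entE //=; ring.
Qed.

Lemma e_mul A k l : (0 < k <= 3)%N -> (0 < l <= 3)%N ->
  e F k l * A = ent A l 1 *: e F k 1 + ent A l 2 *: e F k 2 + ent A l 3 *: e F k 3.
Proof.
move: k l => [|[|[|[|//]]]] [|[|[|[|//]]]] // _ _;
  by apply: ent_ext; split; rewrite !entE //=; ring.
Qed.

Lemma O_ent A :
  O A = ent A 1 1 *: (e F 1 2 + e F 2 3) + ent A 1 2 *: e F 1 3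
    + ent A 2 2 *: e F 2 3 - ent A 2 1 *: e F 1 1
    - ent A 3 2 *: (e F 1 1 + e F 2 2) - ent A 3 1 *: e F 2 1.
Proof.
rewrite {1}[A]sum_e !linearD !linearZ /= !O_e //=.
by apply: ent_ext; split; rewrite !entE //=; ring.
Qed.

Lemma e_mul_e A i j k l : e F i j * A * e F k l = ent A j k *: e F i l.
Proof.
rewrite /e -(mul_delta_mx (0 : 'I_1)).
rewrite -[delta_mx _ (inord l.-1)](mul_delta_mx (0 : 'I_1)) -!mulmxE !mulmxA.
rewrite -[_ *m _ *m A]mulmxA -rowE -[_ *m row _ _ *m _]mulmxA -colE.
rewrite [col _ _]mx11_scalar mul_mx_scalar -scalemxAl mul_delta_mx.
by rewrite /ent !mxE.
Qed.

End Entries.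

(** Reduces an equation to a known one up to a ring identity, which is the
second premise. *)
Lemma lincomb (V : zmodType) (a b c d : V) : a = b -> c - d = a - b -> c = d.
Proof. by move=> ->; rewrite subrr => /eqP; rewrite subr_eq0 => /eqP. Qed.

(** This is [O 1]. *)
Definition N (F : numFieldType) : 'M[F]_3 := e F 1 2 + 2 *: e F 2 3.

Section UnitsN.
Variable F : numFieldType.
Local Notation e := (e F).
Local Notation N := (N F).

Lemma N_e21 : N * e 2 1 = e 1 1.
Proof. by apply: ent_ext; split; rewrite !entE //=; ring. Qed.
Lemma N_e22 : N * e 2 2 = e 1 2.
Proof. by apply: ent_ext; split; rewrite !entE //=; ring. Qed.
Lemma N_e31 : N * e 3 1 = 2 *: e 2 1.
Proof. by apply: ent_ext; split; rewrite !entE //=; ring. Qed.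
Lemma N_e32 : N * e 3 2 = 2 *: e 2 2.
Proof. by apply: ent_ext; split; rewrite !entE //=; ring. Qed.
Lemma N_e33 : N * e 3 3 = 2 *: e 2 3.
Proof. by apply: ent_ext; split; rewrite !entE //=; ring. Qed.
Lemma N_e11 : N * e 1 1 = 0.
Proof. by apply: ent_ext; split; rewrite !entE //=; ring. Qed.
Lemma e11_N : e 1 1 * N = e 1 2.
Proof. by apply: ent_ext; split; rewrite !entE //=; ring. Qed.
Lemma e21_N : e 2 1 * N = e 2 2.
Proof. by apply: ent_ext; split; rewrite !entE //=; ring. Qed.
Lemma e31_N : e 3 1 * N = e 3 2.
Proof. by apply: ent_ext; split; rewrite !entE //=; ring. Qed.
Lemma e22_N : e 2 2 * N = 2 *: e 2 3.
Proof. by apply: ent_ext; split; rewrite !entE //=; ring. Qed.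
Lemma e32_N : e 3 2 * N = 2 *: e 3 3.
Proof. by apply: ent_ext; split; rewrite !entE //=; ring. Qed.
Lemma e33_N : e 3 3 * N = 0.
Proof. by apply: ent_ext; split; rewrite !entE //=; ring. Qed.
Lemma N_N : N * N = 2 *: e 1 3.
Proof. by apply: ent_ext; split; rewrite !entE //=; ring. Qed.
Definition N_units := (N_e21, N_e22, N_e31, N_e32, N_e33, N_e11,
  e11_N, e21_N, e31_N, e22_N, e32_N, e33_N).

Lemma one_e : 1 = e 1 1 + e 2 2 + e 3 3.
Proof. by apply: ent_ext; split; rewrite !entE //=; ring. Qed.
End UnitsN.

(** * The image of R when R 1 = N *)

Section NormalizedUnit.
Variable F : numFieldType.
Local Notation e := (e F).
Local Notation N := (N F).
Variable R : {linear 'M[F]_3 -> 'M[F]_3}.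
Hypothesis R_RB : rota_baxter0 R.
Hypothesis R1 : R 1 = N.
Implicit Types x y A : 'M[F]_3.

Lemma N_R x : N * R x = R (N * x) + R (R x).
Proof. by rewrite -R1 R1_mul. Qed.

Lemma R_N x : R x * N = R (x * N) + R (R x).
Proof. by rewrite -R1 mul_R1. Qed.

Lemma R_comm x : R (N * x) - R (x * N) = N * R x - R x * N.
Proof. by rewrite N_R R_N opprD addrACA subrr addr0. Qed.

(** R integrates the powers of N: it sends N to N^2 / 2 = e13 and N^2 to
N^3 / 3 = 0. *)
Lemma R_N_e13 : R N = e 1 3 /\ R (e 1 3) = 0.
Proof.
have nz2 : (2 : F) != 0 by rewrite pnatr_eq0.
have RN : R N = e 1 3.
  apply: (scalerI nz2); rewrite -N_N scaler_nat mulr2n.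
  by have := N_R 1; rewrite mulr1 R1.
split=> //; have := N_R N; rewrite RN.
have -> : N * e 1 3 = 0 by apply: ent_ext; split; rewrite !entE //=; ring.
rewrite N_N linearZ /= -{2}[R _]scale1r -scalerDl => /esym/eqP.
by rewrite scaler_eq0 -[_ + _](natrD F 2 1) pnatr_eq0 => /eqP.
Qed.

(** There is no term in e13, since R kills it. *)
Lemma R_units x : R x =
  (ent x 1 1 *: R (e 1 1) + ent x 1 2 *: R (e 1 2))
  + (ent x 2 1 *: R (e 2 1) + ent x 2 2 *: R (e 2 2) + ent x 2 3 *: R (e 2 3))
  + (ent x 3 1 *: R (e 3 1) + ent x 3 2 *: R (e 3 2) + ent x 3 3 *: R (e 3 3)).
Proof.
rewrite {1}[x]sum_e; have [_ R0] := R_N_e13.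
by rewrite !linearD !linearZ /= R0 scaler0 addr0.
Qed.

(** For b in the image, N^2 b + N b N + b N^2 is in the image and commutes with
N because N^3 = 0, so it equals 2 b_31 + u N + w N^2. As N and N^2 are values
of R, the corner b_31 must vanish for 1 not to be a value. *)
Lemma image_31 x : ent (R x) 3 1 = 0.
Proof.
apply/eqP/contraT => b31; set b := R x in b31 *.
set L := fun y => N * y + R y; set M := fun y => y * N + R y.
have NR y : N * R y = R (L y) by rewrite N_R linearD.
have RN y : R y * N = R (M y) by rewrite R_N linearD.
set u := 2 * ent b 3 2 + ent b 2 1.
set v := 2 * (ent b 3 3 + ent b 2 2 + ent b 1 1).
have sum_b : N * (N * b) + N * b * N + b * N * N
    - u *: N - v *: e 1 3 = (2 * ent b 3 1) *: 1.
  by apply: ent_ext; split; rewrite !entE //=; rewrite /u /v; ring.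
have : R ((2 * ent b 3 1)^-1 *:
         (L (L x) + M (L x) + M (M x) - u *: 1 - v *: N)) = 1.
  have [RN13 _] := R_N_e13.
  have RN' : R (v *: N) = v *: e 1 3 by rewrite linearZ /= RN13.
  move: L M NR RN => L M NR RN.
  rewrite linearZ 2!linearB 2!linearD /= RN' [R (u *: 1)]linearZ /= R1.
  rewrite -!(NR, RN) sum_b.
  by rewrite scalerA mulVf ?scale1r // mulf_neq0 // pnatr_eq0.
by move/eqP; rewrite (negPf (one_notin_image R_RB _)).
Qed.

(** If the (i,j) entry of every [N, R x] = R [N, x] vanishes, the (i,j) entry
of R is a linear functional killing all [N, x]. Evaluated at the matrix units
this leaves little freedom: the functional is a multiple of trace on the
diagonal, and R 1 = N makes that multiple zero. *)
Lemma R_units_entry0 i j :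
    (forall x, ent (N * R x) i j = ent (R x * N) i j) -> ent N i j = 0 ->
  [/\ ent (R (e 1 1)) i j = 0, ent (R (e 2 2)) i j = 0 & ent (R (e 3 3)) i j = 0]
  /\ [/\ ent (R (e 1 2)) i j = 0, ent (R (e 2 3)) i j = 0
       & ent (R (e 3 2)) i j = 2 * ent (R (e 2 1)) i j].
Proof.
have nz2 : (2 : F) != 0 by rewrite pnatr_eq0.
have nz6 : (6 : F) != 0 by rewrite pnatr_eq0.
move=> comm Nij.
have C x : ent (R (N * x)) i j = ent (R (x * N)) i j.
  apply/eqP; rewrite -subr_eq0 -entN -entD R_comm entD entN comm subrr //.
have C11 := C (e 1 1); rewrite !N_units linear0 ent0 in C11.
have C33 := C (e 3 3); rewrite !N_units linear0 ent0 linearZ entZ in C33.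
have C31 := C (e 3 1); rewrite !N_units linearZ entZ in C31.
have C21 := C (e 2 1); rewrite !N_units in C21.
have C32 := C (e 3 2); rewrite !N_units !linearZ !entZ in C32.
have S : ent (R (e 1 1)) i j + ent (R (e 2 2)) i j + ent (R (e 3 3)) i j = 0.
  by rewrite -!entD -!linearD -one_e R1.
have E22 : ent (R (e 2 2)) i j = 0.
  apply: (mulfI nz6); rewrite mulr0.
  by apply: (lincomb (congr2 +%R (congr1 ( *%R 2) S) C32)); rewrite C21; ring.
have E33 : ent (R (e 3 3)) i j = 0.
  by apply: (mulfI nz2); rewrite -C32 E22 !mulr0.
split; split=> //; first by rewrite C21.
by apply: (mulfI nz2); rewrite C33 mulr0.
Qed.
End NormalizedUnit.

Section ImageShape.
Variable F : numFieldType.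
Local Notation e := (e F).
Local Notation N := (N F).
Variable R : {linear 'M[F]_3 -> 'M[F]_3}.
Hypothesis R_RB : rota_baxter0 R.
Hypothesis R1 : R 1 = N.
Implicit Types x y A : 'M[F]_3.

(** If the image were upper triangular, R would send upper triangular matrices
to strictly upper triangular ones, and each of these to a multiple of e13.
Writing the diagonal units as N x or x N, with x one of e21 and e32, shows that
their values lie on the line of e13 too, against R 1 = N. *)
Lemma image_not_upper :
  (forall x, ent (R x) 2 1 = 0) -> (forall x, ent (R x) 3 2 = 0) -> False.
Proof.
move=> b21 b32; have b31 := image_31 R_RB R1.
have nz2 : (2 : F) != 0 by rewrite pnatr_eq0.
have D11 := @R_units_entry0 _ _ R_RB R1 1 1.
case: D11 => [x||[u11 v11 w11] [p11 q11 _]];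
  [by rewrite !entE //= b21; ring | by rewrite !entE //=; ring |].
have D22 := @R_units_entry0 _ _ R_RB R1 2 2.
case: D22 => [x||[u22 v22 w22] [p22 q22 _]];
  [by rewrite !entE //= b21 b32; ring | by rewrite !entE //=; ring |].
have D33 := @R_units_entry0 _ _ R_RB R1 3 3.
case: D33 => [x||[u33 v33 w33] [p33 q33 _]];
  [by rewrite !entE //= b32; ring | by rewrite !entE //=; ring |].
have p12 : ent (R (e 1 2)) 1 2 = 0.
  have := congr1 (fun A => ent A 1 2) (R_comm R_RB R1 (e 1 1)).
  rewrite !N_units linear0 sub0r entN => /eqP.
  by rewrite eqr_oppLR => /eqP ->; rewrite !entE //= b32 u11 u22; ring.
have q12 : ent (R (e 2 3)) 1 2 = 0.
  apply: (mulfI nz2); rewrite mulr0 -entZ -linearZ -N_e33.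
  have := congr1 (fun A => ent A 1 2) (R_comm R_RB R1 (e 3 3)).
  rewrite e33_N linear0 subr0 => ->.
  by rewrite !entE //= w11 w22 b32; ring.
have RR x : [/\ ent (R (R x)) 1 1 = 0, ent (R (R x)) 2 2 = 0
              & ent (R (R x)) 3 3 = 0].
  by split; rewrite (R_units R_RB R1 (R x)) !entE // b21 b31 b32
    ?(u11, u22, u33, v11, v22, v33, w11, w22, w33, p11, p22, p33, q11, q22, q33);
    ring.
have RR12 x : ent (R x) 1 1 = 0 -> ent (R x) 2 2 = 0 -> ent (R x) 3 3 = 0 ->
    ent (R (R x)) 1 2 = 0.
  move=> x1 x2 x3; rewrite (R_units R_RB R1 (R x)) !entE //.
  by rewrite b21 b31 b32 x1 x2 x3 p12 q12; ring.
have d32 : [/\ ent (R (e 3 2)) 1 1 = 0, ent (R (e 3 2)) 2 2 = 0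
              & ent (R (e 3 2)) 3 3 = 0].
  have [r1 r2 r3] := RR (e 3 1).
  have E i j : ent (R (e 3 2)) i j = ent (R (e 3 1) * N - R (R (e 3 1))) i j.
    by rewrite (R_N R_RB R1) e31_N addrK.
  by split; rewrite E !entE //= ?b21 ?b31 ?b32 ?r1 ?r2 ?r3; ring.
have d21 : [/\ ent (R (e 2 1)) 1 1 = 0, ent (R (e 2 1)) 2 2 = 0
              & ent (R (e 2 1)) 3 3 = 0].
  have [r1 r2 r3] := RR (e 3 1).
  have E i j : 2 * ent (R (e 2 1)) i j = ent (N * R (e 3 1) - R (R (e 3 1))) i j.
    by rewrite (N_R R_RB R1) N_e31 addrK linearZ entZ.
  by split; apply: (mulfI nz2); rewrite E !entE //= ?b21 ?b31 ?b32 ?r1 ?r2 ?r3;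
    ring.
have [x1 x2 x3] := d32; have [y1 y2 y3] := d21.
have t1 : ent (R (e 1 1)) 1 2 = 0.
  have -> : R (e 1 1) = N * R (e 2 1) - R (R (e 2 1)).
    by rewrite (N_R R_RB R1) N_e21 addrK.
  by rewrite entD entN RR12 // !entE //= y2 b32; ring.
have t2 : ent (R (e 2 2)) 1 2 = 0.
  apply: (mulfI nz2); rewrite mulr0 -entZ -linearZ -N_e32.
  have -> : R (N * e 3 2) = N * R (e 3 2) - R (R (e 3 2)).
    by rewrite (N_R R_RB R1) addrK.
  by rewrite entD entN RR12 // !entE //= x2 b32; ring.
have t3 : ent (R (e 3 3)) 1 2 = 0.
  apply: (mulfI nz2); rewrite mulr0 -entZ -linearZ -e32_N.
  have -> : R (e 3 2 * N) = R (e 3 2) * N - R (R (e 3 2)).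
    by rewrite (R_N R_RB R1) addrK.
  by rewrite entD entN RR12 // !entE //= x1; ring.
have := congr1 (fun A => ent A 1 2) R1.
rewrite one_e !linearD !entE //= t1 t2 t3 => /eqP.
by rewrite !addr0 mulr0 addr0 eq_sym oner_eq0.
Qed.

(** By [image_31], the (3,1) entry of R x * R y reduces to a single product. *)
Lemma image_32_or_21 :
  (forall x, ent (R x) 3 2 = 0) \/ (forall x, ent (R x) 2 1 = 0).
Proof.
have b31 := image_31 R_RB R1.
have P x y : ent (R x) 3 2 * ent (R y) 2 1 = 0.
  have := congr1 (fun A => ent A 3 1) (R_RB x y).
  by rewrite b31 entM !b31 mul0r mulr0 add0r addr0.
have [[x bx]|nx] := pselect (exists x, ent (R x) 3 2 != 0).
  by right=> y; apply: (mulfI bx); rewrite P mulr0.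
by left=> x; apply/eqP; apply: contrapT => /negP bx; apply: nx; exists x.
Qed.

Lemma image_21_neq0 : (forall x, ent (R x) 3 2 = 0) ->
  exists x, ent (R x) 2 1 != 0.
Proof.
move=> b32; apply: contrapT => nx; apply: image_not_upper => // x.
by apply/eqP; apply: contrapT => /negP bx; apply: nx; exists x.
Qed.
End ImageShape.

(** * Vanishing of the last row and of the last column *)

Section LastRow.
Variable F : numFieldType.
Local Notation e := (e F).
Local Notation N := (N F).
Variable R : {linear 'M[F]_3 -> 'M[F]_3}.
Hypothesis R_RB : rota_baxter0 R.
Hypothesis R1 : R 1 = N.
Hypothesis b32 : forall x, ent (R x) 3 2 = 0.
Implicit Types x y A : 'M[F]_3.

Let b31 := image_31 R_RB R1.
Let nz2 : (2 : F) != 0. Proof. by rewrite pnatr_eq0. Qed.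

(** Since (3,1) and (3,2) entries vanish on the image, the (3,3) entry is
multiplicative there. As a functional f of the argument it has the form
f y = p (y_21 + 2 y_32) + t y_31.
If p were nonzero, f (N y) + f (R y) = 0 would give (R y)_21 = - 2 y_31; the
Rota-Baxter identity then determines diagonal entries of R e21 and R e32, and
they contradict 2 R e21 - R e32 = [N, R e31]. Once p = 0, multiplicativity
at e32 and x0 reads t (R x0)_21 = 0, and some (R x0)_21 is nonzero. *)
Lemma image_33 x : ent (R x) 3 3 = 0.
Proof.
have D33 := @R_units_entry0 _ _ R_RB R1 3 3.
case: D33 => [y||[u1 u2 u3] [p1 q1 r1]];
  [by rewrite !entE //= b32; ring | by rewrite !entE //=; ring |].
set p := ent (R (e 2 1)) 3 3 in r1 *; set t := ent (R (e 3 1)) 3 3.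
have f y : ent (R y) 3 3 = ent y 2 1 * p + ent y 3 2 * (2 * p) + ent y 3 1 * t.
  by rewrite (R_units R_RB R1 y) !entE // u1 u2 u3 p1 q1 r1 -/p -/t; ring.
have RB33 x' y : ent (R x') 3 3 * ent (R y) 3 3
    = ent (R x' * y + x' * R y) 2 1 * p + ent (R x' * y + x' * R y) 3 2 * (2 * p)
      + ent (R x' * y + x' * R y) 3 1 * t.
  by rewrite -f -R_RB entM b31 b32; ring.
have p0 : p = 0.
  apply/eqP/contraT => pN0.
  have b21 y : ent (R y) 2 1 = - 2 * ent y 3 1.
    apply: (mulfI pN0).
    have := congr1 (fun A => ent A 3 3) (N_R R_RB R1 y).
    rewrite entD 2!f b31 b32 !entE //= => E.
    by apply: (lincomb (esym E)); ring.
  have RB21 x' y := congr1 (fun A => ent A 2 1) (R_RB x' y).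
  have d22 : ent (R (e 2 1)) 2 2 = p.
    have := RB21 (e 2 1) (e 3 1); rewrite b21 !entE //= !b21 !b31 !entE //= -/p => E.
    by apply: (mulfI nz2); apply: (lincomb (esym E)); ring.
  have d11 : ent (R (e 2 1)) 1 1 = 0.
    have := RB33 (e 2 1) (e 2 1); rewrite !entE //= !b31 !b32 d22 -/p => E.
    by apply: (mulfI pN0); apply: (lincomb (esym E)); ring.
  have d11' : ent (R (e 3 2)) 1 1 = 0.
    have := RB33 (e 2 1) (e 3 2); rewrite !entE //= !b31 !b32 r1 -/p => E.
    by apply: (mulfI pN0); apply: (lincomb (esym E)); ring.
  have := congr1 (fun A => ent A 1 1) (R_comm R_RB R1 (e 3 1)).
  rewrite !N_units linearZ !entE //= d11 d11' !b21 b31 !entE //= => E.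
  by rewrite -(negbTE nz2); apply/eqP; apply: (lincomb E); ring.
have [x0 bx0] := image_21_neq0 R_RB R1 b32.
have t0 : t = 0.
  apply: (mulfI bx0); have := RB33 (e 3 2) x0.
  rewrite r1 p0 !entE //= !b31 !b32 r1 p0 => E.
  by apply: (lincomb (esym E)); ring.
by rewrite f p0 t0; ring.
Qed.

(** If (R x0)_21 != 0, the identity for x0 and e13 gives R e23 = 0. Then
g = R e33 commutes with N, which with R g = g N leaves g = k e13; the identity
for e33 and e32 kills k, as g R e32 = e33 R e32 = 0 and g e32 = k e12. *)
Lemma R_col3 : R (e 2 3) = 0 /\ R (e 3 3) = 0.
Proof.
have b33 := image_33.
have [x0 bx0] := image_21_neq0 R_RB R1 b32.
have [RN R13] := R_N_e13 R_RB R1.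
have R23 : R (e 2 3) = 0.
  apply: (scalerI bx0); have := R_RB x0 (e 1 3).
  rewrite R13 !mulr0 addr0 mul_e // b31 !linearD !linearZ /= R13.
  by rewrite !scaler0 scale0r add0r addr0.
split=> //; set g := R (e 3 3).
have Eg := R_comm R_RB R1 (e 3 3).
rewrite !N_units linear0 linearZ /= R23 scaler0 subr0 -/g in Eg.
have gij i j := congr1 (fun A => ent A i j) Eg.
have [g31 g32 g33] : [/\ ent g 3 1 = 0, ent g 3 2 = 0 & ent g 3 3 = 0].
  by rewrite /g b31 b32 b33.
have g21 : ent g 2 1 = 0.
  by have := gij 1 1; rewrite !entE //= => E; apply: (lincomb (esym E)); ring.
have g22 : ent g 2 2 = 0.
  have := gij 2 3; rewrite !entE //= g33 => E.
  by apply: (mulfI nz2); apply: (lincomb E); ring.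
have g11 : ent g 1 1 = 0.
  by have := gij 1 2; rewrite !entE //= g22 g32 => E; apply: (lincomb E); ring.
have g23 : ent g 2 3 = 2 * ent g 1 2.
  by have := gij 1 3; rewrite !entE //= g33 => E; apply: (lincomb (esym E)); ring.
have Eg12 : g = ent g 1 2 *: N + ent g 1 3 *: e 1 3.
  by apply: ent_ext; split;
    rewrite !entE //= ?(g11, g21, g22, g23, g31, g32, g33); ring.
have Rg : R g = ent g 1 2 *: e 1 3.
  rewrite {1}Eg12 linearD (linearZ _ N) [R (_ *: e 1 3)]linearZ /= RN R13.
  by rewrite scaler0 addr0.
have g12 : ent g 1 2 = 0.
  have := congr1 (fun A => ent A 1 3) (R_N R_RB R1 (e 3 3)).
  rewrite -/g e33_N linear0 add0r Rg !entE //= => E.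
  by apply: (lincomb E); ring.
have R12 : R (e 1 2) = e 1 3.
  by rewrite -RN linearD linearZ /= R23 scaler0 addr0.
have := congr1 (fun A => ent A 1 3) (R_RB (e 3 3) (e 3 2)).
rewrite -/g mul_e // e_mul // g33 g23 g12 !b31 !b32 !b33 /=.
rewrite !(mulr0, scale0r, addr0) linearZ /= R12.
rewrite !entE //= g11 g12 !b33 => E.
have g13 : ent g 1 3 = 0 by apply: (lincomb (esym E)); ring.
by rewrite Eg12 g12 g13 !scale0r addr0.
Qed.

End LastRow.

(** * The values of R on the matrix units *)

Section Values.
Variable F : numFieldType.
Local Notation e := (e F).
Local Notation N := (N F).
Variable R : {linear 'M[F]_3 -> 'M[F]_3}.
Hypothesis R_RB : rota_baxter0 R.
Hypothesis R1 : R 1 = N.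
Hypothesis b32 : forall x, ent (R x) 3 2 = 0.
Implicit Types x y A : 'M[F]_3.

Let nz2 : (2 : F) != 0. Proof. by rewrite pnatr_eq0. Qed.

(** Each unknown X = R e_ij has last row 0, and [N, X] = R [N, e_ij] is known
from earlier values; this determines X up to adding a combination of N and e13.
The relation X N = R (e_ij N) + R X, read at (1,3), fixes the coefficient of N,
because it occurs on the left with twice the factor it has on the right. The
coefficient of e13 is fixed by the quadratic identity for (e32, e32) and
(e31, e31); the one in R e21 remains free. *)
Lemma R_values : exists nu,
  [/\ R (e 1 2) = e 1 3, R (e 2 2) = e 2 3 & R (e 1 1) = e 1 2 + e 2 3] /\
  [/\ R (e 3 2) = - (e 1 1 + e 2 2), R (e 2 1) = - e 1 1 + nu *: e 1 3
    & R (e 3 1) = - e 2 1 - nu *: e 1 2].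
Proof.
have b31 := image_31 R_RB R1; have b33 := image_33 R_RB R1 b32.
have [R23 R33] := R_col3 R_RB R1 b32; have [RN R13] := R_N_e13 R_RB R1.
have R12 : R (e 1 2) = e 1 3.
  by rewrite -RN linearD linearZ /= R23 scaler0 addr0.
have Rx x : R x = ent x 1 1 *: R (e 1 1) + ent x 1 2 *: e 1 3
    + ent x 2 1 *: R (e 2 1) + ent x 2 2 *: R (e 2 2)
    + ent x 3 1 *: R (e 3 1) + ent x 3 2 *: R (e 3 2).
  by rewrite (R_units R_RB R1 x) R12 R23 R33 !scaler0 !addr0 !addrA.
have C i j x := congr1 (fun A => ent A i j) (R_comm R_RB R1 x).
have P x := congr1 (fun A => ent A 1 3) (R_N R_RB R1 x).
set x11 := R (e 1 1) in Rx *; set x22 := R (e 2 2) in Rx *.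
have x11E : x11 = N - x22.
  by rewrite -R1 one_e !linearD R33 addr0 addrK.
(* The identity for (e32, e32), used below, will show k = 0. *)
have [k Ek] : exists k, x22 = e 2 3 + k *: e 1 3.
  pose X i j := C i j (e 2 2).
  have X21 : ent x22 2 1 = 0.
    have := X 1 1; rewrite !N_units linearZ /= R12 R23 !entE //= b31 => E.
    by apply: (lincomb (esym E)); ring.
  have X22 : ent x22 2 2 = 0.
    have := X 2 3; rewrite !N_units linearZ /= R12 R23 !entE //= b33 => E.
    by apply: (mulfI nz2); apply: (lincomb E); ring.
  have X11 : ent x22 1 1 = 0.
    have := X 1 2; rewrite !N_units linearZ /= R12 R23 !entE //= b32 X22 => E.
    by apply: (lincomb E); ring.
  have X23 : ent x22 2 3 = 1 + 2 * ent x22 1 2.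
    have := X 1 3; rewrite !N_units linearZ /= R12 R23 !entE //= b33 => E.
    by apply: (lincomb (esym E)); ring.
  have X12 : ent x22 1 2 = 0.
    have := P (e 2 2); rewrite e22_N linearZ /= R23 -/x22 [R x22]Rx.
    rewrite X11 X22 X21 !b31 !b32 !entE //= => E.
    by apply: (lincomb E); ring.
  exists (ent x22 1 3); apply: ent_ext; split; rewrite !entE //=
    ?(X11, X12, X21, X22, X23) ?b31 ?b32 ?b33; ring.
set X := R (e 3 2) in Rx *.
have [X21 X31 X32 X33] :
    [/\ ent X 2 1 = 0, ent X 3 1 = 0, ent X 3 2 = 0 & ent X 3 3 = 0].
  split; rewrite ?b31 ?b32 ?b33 //.
  have := C 1 1 (e 3 2); rewrite !N_units !linearZ /= R33 -/x22 Ek.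
  rewrite !entE //= b31 => E.
  by apply: (lincomb (esym E)); ring.
have X22 : ent X 2 2 = - 1.
  have := C 2 3 (e 3 2); rewrite !N_units !linearZ /= R33 -/x22 Ek.
  rewrite !entE //= b33 => E.
  by apply: (mulfI nz2); apply: (lincomb E); ring.
have X11 : ent X 1 1 = - 1.
  have := C 1 2 (e 3 2); rewrite !N_units !linearZ /= R33 -/x22 Ek.
  rewrite !entE //= -/X X22 X32 => E.
  by apply: (lincomb E); ring.
have X23 : ent X 2 3 = 2 * k + 2 * ent X 1 2.
  have := C 1 3 (e 3 2); rewrite !N_units !linearZ /= R33 -/x22 Ek.
  rewrite !entE //= -/X X33 => E.
  by apply: (lincomb (esym E)); ring.
have X12 : ent X 1 2 = 0.
  have := P (e 3 2); rewrite e32_N linearZ /= R33 -/X [R X]Rx X11 X22 X21 X31 X32.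
  rewrite x11E Ek !entE //= => E.
  by apply: (lincomb E); ring.
have RX : R (X * e 3 2 + e 3 2 * X) = (ent X 1 3 + k * ent X 2 3) *: e 1 3
   + ent X 2 3 *: e 2 3 - X.
  rewrite Rx mul_e // e_mul // !entE //= X22 X21 X33 Ek.
  by apply: ent_ext; split; rewrite !entE //=; ring.
have XX := R_RB (e 3 2) (e 3 2); rewrite -/X RX in XX.
have k0 : k = 0.
  have := congr1 (fun A => ent A 2 3) XX.
  rewrite !entE //= X22 X21 X23 X33 X12 => E.
  by apply: (mulfI nz2); apply: (lincomb (esym E)); ring.
have X13 : ent X 1 3 = 0.
  have := congr1 (fun A => ent A 1 3) XX.
  rewrite !entE //= X12 X11 X33 X23 k0 X12 => E.
  by apply: (lincomb (esym E)); ring.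
have EX : X = - (e 1 1 + e 2 2).
  by apply: ent_ext; split; rewrite !entE //=
    ?(X11, X12, X13, X21, X22, X23, X31, X32, X33, k0); ring.
rewrite {}k0 scale0r addr0 in Ek.
have E11 : x11 = e 1 2 + e 2 3.
  by rewrite x11E Ek; apply: ent_ext; split; rewrite !entE //=; ring.
have [nu E21] : exists nu, R (e 2 1) = - e 1 1 + nu *: e 1 3.
  set Y := R (e 2 1) in Rx *.
  have CY i j := C i j (e 2 1).
  have Y21 : ent Y 2 1 = 0.
    have := CY 1 1; rewrite !N_units -/x11 -/x22 E11 Ek !entE //= b31 => E.
    by apply: (lincomb (esym E)); ring.
  have Y22 : ent Y 2 2 = 0.
    have := CY 2 3; rewrite !N_units -/x11 -/x22 E11 Ek !entE //= b33 => E.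
    by apply: (mulfI nz2); apply: (lincomb E); ring.
  have Y11 : ent Y 1 1 = - 1.
    have := CY 1 2; rewrite !N_units -/x11 -/x22 E11 Ek !entE //= b32 -/Y Y22 => E.
    by apply: (lincomb E); ring.
  have Y23 : ent Y 2 3 = 2 * ent Y 1 2.
    have := CY 1 3; rewrite !N_units -/x11 -/x22 E11 Ek !entE //= b33 => E.
    by apply: (lincomb (esym E)); ring.
  have Y12 : ent Y 1 2 = 0.
    have := P (e 2 1); rewrite e21_N -/Y -/x22 [R Y]Rx Y11 Y22 Y21 !b31 !b32.
    rewrite E11 Ek !entE //= => E.
    by apply: (lincomb E); ring.
  exists (ent Y 1 3); apply: ent_ext; split; rewrite !entE //=
    ?(Y11, Y12, Y21, Y22, Y23) ?b31 ?b32 ?b33; ring.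
exists nu; split; split=> //.
set Y := R (e 3 1) in Rx *.
have CY i j := C i j (e 3 1).
rewrite !N_units linearZ /= E21 -/X EX -/Y in CY.
have [Y31 Y32 Y33] : [/\ ent Y 3 1 = 0, ent Y 3 2 = 0 & ent Y 3 3 = 0].
  by rewrite /Y b31 b32 b33.
have Y21 : ent Y 2 1 = - 1.
  by have := CY 1 1; rewrite !entE //= => E; apply: (lincomb (esym E)); ring.
have Y22 : ent Y 2 2 = 0.
  have := CY 2 3; rewrite !entE //= Y33 => E.
  by apply: (mulfI nz2); apply: (lincomb E); ring.
have Y11 : ent Y 1 1 = 0.
  by have := CY 1 2; rewrite !entE //= Y22 Y32 => E; apply: (lincomb E); ring.
have Y23 : ent Y 2 3 = 2 * nu + 2 * ent Y 1 2.
  by have := CY 1 3; rewrite !entE //= Y33 => E; apply: (lincomb (esym E)); ring.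
have Y12 : ent Y 1 2 = - nu.
  have := P (e 3 1); rewrite e31_N -/X -/Y [R Y]Rx Y11 Y22 Y21 Y31 Y32.
  rewrite EX E21 !entE //= => E.
  by apply: (lincomb E); ring.
have Y13 : ent Y 1 3 = 0.
  have := congr1 (fun A => ent A 1 2) (R_RB (e 3 1) (e 3 1)).
  rewrite -/Y mul_e // e_mul // Rx !entE //= Y11 Y12 Y22 Y33 Y23 Y32.
  rewrite E11 EX Ek E21 !entE //= => E.
  by apply: (lincomb (esym E)); ring.
by apply: ent_ext; split; rewrite !entE //=
    ?(Y11, Y12, Y13, Y21, Y22, Y23, Y31, Y32, Y33); ring.
Qed.
End Values.

(** * Conjugation to O *)

Definition conj_to_O (F : numFieldType) (R : 'M[F]_3 -> 'M[F]_3) :=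
  exists P Q : 'M[F]_3,
    [/\ P * Q = 1, Q * P = 1 & forall x, R x = inner Q P (O (inner P Q x))].

Lemma conj_to_O_inner (F : numFieldType) (R : 'M[F]_3 -> 'M[F]_3) (P Q : 'M[F]_3) :
  P * Q = 1 -> Q * P = 1 ->
  conj_to_O (inner P Q \o R \o inner Q P) -> conj_to_O R.
Proof.
move=> PQ QP [S [T [ST TS RE]]]; exists (S * P), (Q * T); split.
- by rewrite mulrA -[S * P * Q]mulrA PQ mulr1.
- by rewrite mulrA -[Q * T * S]mulrA TS mulr1.
move=> x; have := RE (inner P Q x); rewrite /= innerK // => E.
by rewrite -[LHS](innerK QP) E /inner !mulrA.
Qed.

Section Assembly.
Variable F : numFieldType.
Local Notation e := (e F).
Local Notation N := (N F).
Implicit Type R : {linear 'M[F]_3 -> 'M[F]_3}.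

Lemma inner_transvection a z : inner (1 + a *: e 1 3) (1 - a *: e 1 3) z =
  z + a *: (e 1 3 * z) - a *: (z * e 1 3) - (a ^+ 2 * ent z 3 1) *: e 1 3.
Proof.
rewrite /inner mulrDl mul1r mulrBr mulr1 mulrDl -!scalerAl -!scalerAr e_mul_e.
by rewrite !scalerA opprD addrA -expr2.
Qed.

(** Conjugation by 1 + a e13 fixes N and adds a multiple of e13 to R e21, so it
can remove the parameter of [R_values]. *)
Lemma normal_form R : rota_baxter0 R -> R 1 = N ->
  (forall x, ent (R x) 3 2 = 0) -> conj_to_O R.
Proof.
move=> R_RB R1 b32.
have [nu [[R12 R22 R11] [R32 R21 R31]]] := R_values R_RB R1 b32.
have [R23 R33] := R_col3 R_RB R1 b32.
exists (1 - nu *: e 1 3), (1 + nu *: e 1 3); split.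
- by apply: ent_ext; split; rewrite !entE //=; ring.
- by apply: ent_ext; split; rewrite !entE //=; ring.
move=> x; set y := inner _ _ x.
have [y11 y12] : ent y 1 1 = ent x 1 1 - nu * ent x 3 1
    /\ ent y 1 2 = ent x 1 2 - nu * ent x 3 2.
  by rewrite /y /inner !entE //=; split; ring.
have [y21 y22] : ent y 2 1 = ent x 2 1 /\ ent y 2 2 = ent x 2 2.
  by rewrite /y /inner !entE //=; split; ring.
have [y31 y32] : ent y 3 1 = ent x 3 1 /\ ent y 3 2 = ent x 3 2.
  by rewrite /y /inner !entE //=; split; ring.
clearbody y; rewrite (R_units R_RB R1 x) R11 R12 R21 R22 R23 R31 R32 R33.
rewrite inner_transvection mul_e // e_mul // {1}O_ent y11 y12 y21 y22 y31 y32.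
have [z11 z21 z31] : [/\ ent (O y) 1 1 = - ent y 2 1 - ent y 3 2,
    ent (O y) 2 1 = - ent y 3 1 & ent (O y) 3 1 = 0].
  by rewrite O_ent; split; rewrite !entE //=; ring.
have [z32 z33] : ent (O y) 3 2 = 0 /\ ent (O y) 3 3 = 0.
  by rewrite O_ent; split; rewrite !entE //=; ring.
rewrite z11 z21 z31 z32 z33 y21 y31 y32.
by apply: ent_ext; split; rewrite !entE //=; ring.
Qed.

(** If (r^2)_ij = c != 0, the i-th rows of 1, r, r^2 / 2 are the rows of a matrix
P with P r = N P. The j-th columns of r^2, r, 2 form a matrix S with r S = S N,
and P S = T is a polynomial in N with constant term c, hence invertible; so
S T^-1 is the inverse of P. *)
Lemma regular_nilpotent_conj (r : 'M[F]_3) : r ^+ 3 = 0 -> r ^+ 2 != 0 ->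
  exists P Q : 'M[F]_3, [/\ P * Q = 1, Q * P = 1 & inner P Q r = N].
Proof.
rewrite !exprS expr0 mulr1 => r3 r2.
have [i [j c0]] : exists i j, ent (r * r) i j != 0.
  have [k [l rkl]] := matrix0Pn _ r2.
  by exists k.+1, l.+1; rewrite /ent !inord_val.
set c := ent (r * r) i j in c0; set s := ent r i j; set d : F := ent 1 i j.
have nz2 : (2 : F) != 0 by rewrite pnatr_eq0.
set P := e 1 i + e 2 i * r + 2^-1 *: (e 3 i * r * r).
have PN : P * r = N * P.
  have Ne (k : nat) : e k i = e k 1 * e 1 i by rewrite /e -mulmxE mul_delta_mx.
  have N1 : N * e 1 i = 0 by rewrite (Ne 1%N) mulrA N_e11 mul0r.
  have N2 : N * e 2 i = e 1 i by rewrite (Ne 2%N) mulrA N_e21 -Ne.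
  have N3 : N * e 3 i = 2 *: e 2 i.
    by rewrite (Ne 3%N) (Ne 2%N) mulrA N_e31 scalerAl.
  rewrite [in LHS]/P 2!mulrDl -scalerAl -!mulrA r3 mulr0 scaler0 addr0.
  rewrite /P 2!mulrDr -scalerAr !mulrA N1 N2 N3 -!scalerAl scalerA.
  by rewrite mulVf // scale1r add0r.
set S := r * r * e j 1 + r * e j 2 + 2 *: e j 3.
set T := c *: 1 + s *: N + (2 * d) *: e 1 3.
have PS : P * S = T.
  have E k l A : e k i * (A * e j l) = ent A i j *: e k l by rewrite mulrA e_mul_e.
  have rS : r * S = r * r * e j 2 + 2 *: (r * e j 3).
    by rewrite /S 2!mulrDr -scalerAr !mulrA -(mulrA r r r) r3 mul0r add0r.
  have rrS : r * (r * S) = 2 *: (r * r * e j 3).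
    by rewrite rS mulrDr -scalerAr !mulrA -(mulrA r r r) r3 mul0r add0r.
  have P1 : e 1 i * S = c *: e 1 1 + s *: e 1 2 + (2 * d) *: e 1 3.
    by rewrite /S -[e j 3]mul1r 2!mulrDr -scalerAr !E scalerA.
  have P2 : e 2 i * r * S = c *: e 2 2 + (2 * s) *: e 2 3.
    by rewrite -mulrA rS mulrDr -scalerAr !E scalerA.
  have P3 : e 3 i * r * r * S = (2 * c) *: e 3 3.
    by rewrite -!mulrA rrS -scalerAr !E scalerA.
  rewrite [in LHS]/P 2!mulrDl -scalerAl P1 P2 P3 /T.
  by apply: ent_ext; split; rewrite !entE //=; field.
(* Inverse of T = c + s N + d N^2, truncated at N^3 = 0; recall e13 = N^2 / 2. *)
set W := c^-1 *: 1 - (s * c^-2) *: N + (2 * s ^+ 2 * c^-3 - 2 * d * c^-2) *: e 1 3.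
have TW : T * W = 1.
  by apply: ent_ext; split; rewrite !entE //=; field.
have PSW : P * (S * W) = 1 by rewrite mulrA PS TW.
have SWP : S * W * P = 1 by apply: mulmx1C.
exists P, (S * W); split=> //.
by rewrite /inner PN -mulrA PSW mulr1.
Qed.
End Assembly.

Section Main.
Variable F : numFieldType.
Local Notation e := (e F).
Local Notation N := (N F).
Implicit Type R : {linear 'M[F]_3 -> 'M[F]_3}.

Lemma trmxM (A B : 'M[F]_3) : (A * B)^T = B^T * A^T.
Proof. exact: trmx_mul. Qed.

Lemma trmxM1 (A B : 'M[F]_3) : A * B = 1 -> B^T * A^T = 1.
Proof. by move=> AB; rewrite -trmxM AB trmx1. Qed.

Lemma inner_trmx (P Q x : 'M[F]_3) : (inner P Q x)^T = inner Q^T P^T x^T.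
Proof. by rewrite /inner !trmxM mulrA. Qed.

(** The antiautomorphism x |-> U x^T V fixes N and exchanges the entries (2,1)
and (3,2) up to scalars. *)
Lemma conj_to_O_N R : rota_baxter0 R -> R 1 = N ->
  conj_to_O R \/ conj_to_O (trmx \o R \o trmx).
Proof.
move=> R_RB R1; have [b32|b21] := image_32_or_21 R_RB R1.
  by left; apply: normal_form.
right; set U := e 1 3 + 2 *: e 2 2 + e 3 1; set V := e 1 3 + 2^-1 *: e 2 2 + e 3 1.
have UV : U * V = 1 by apply: ent_ext; split; rewrite !entE //=; field.
have VU : V * U = 1 by apply: ent_ext; split; rewrite !entE //=; field.
pose f : {linear 'M[F]_3 -> 'M[F]_3} := inner U V \o trmx.
pose g : {linear 'M[F]_3 -> 'M[F]_3} := trmx \o inner V U.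
have fK : cancel f g by move=> x; rewrite /= innerK // trmxK.
have gK : cancel g f by move=> x; rewrite /= trmxK innerK.
have fM : {morph f : x y / x * y >-> y * x}.
  by move=> x y /=; rewrite trmxM innerM.
have entT (A : 'M[F]_3) i j : ent A^T i j = ent A j i by rewrite /ent mxE.
apply: (conj_to_O_inner UV VU); apply: (@normal_form F (f \o R \o g)).
- exact: (rota_baxter0_transport fK gK (or_intror fM)).
- rewrite /= /inner mulr1 VU trmx1 R1.
  by apply: ent_ext; split; rewrite !(entE, entT) //=; field.
move=> x; rewrite /= /inner.
set y := R _; have y21 : ent y 2 1 = 0 by apply: b21.
by clearbody y; rewrite !(entE, entT) //= y21; ring.
Qed.

Lemma conj_to_O_or_tr R : rota_baxter0 R -> (R 1) ^+ 2 != 0 ->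
  conj_to_O R \/ conj_to_O (trmx \o R \o trmx).
Proof.
move=> R_RB r2.
have [P [Q [PQ QP PR]]] := regular_nilpotent_conj (R1_nilpotent R_RB) r2.
have PK := innerK PQ; have QK := innerK QP.
have S_RB := rota_baxter0_transport QK PK (or_introl (innerM QP)) R_RB.
have S1 : (inner P Q \o R \o inner Q P) 1 = N.
  by rewrite /= {2}/inner mulr1 QP PR.
have [S_O|S_O] := conj_to_O_N S_RB S1; [left | right].
  exact: (conj_to_O_inner PQ QP S_O).
apply: (conj_to_O_inner (trmxM1 PQ) (trmxM1 QP)).
have [A [B [AB BA E]]] := S_O; exists A, B; split=> // x; rewrite -E /=.
by rewrite !inner_trmx !trmxK.
Qed.
End Main.

Theorem lemma2 (K : realType)
    (R : {linear 'M[K[i]]_3 -> 'M[K[i]]_3})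
    (R_RB : rota_baxter0 R) (R1_neq0 : (R 1) ^+ 2 != 0) :
  exists (phi : {lrmorphism 'M[K[i]]_3 -> 'M[K[i]]_3})
         (phi' : 'M[K[i]]_3 -> 'M[K[i]]_3) (c : K[i]),
    [/\ cancel phi phi', cancel phi' phi, c != 0
      & (forall x, R x = c *: conjugate phi phi' (@O K[i]) x)
        \/ (forall x, R x =
              c *: conjugate trmx trmx (conjugate phi phi' (@O K[i])) x)].
Proof.
have aut (P Q : 'M[K[i]]_3) : P * Q = 1 -> Q * P = 1 ->
    exists2 phi : {lrmorphism 'M[K[i]]_3 -> 'M[K[i]]_3},
      cancel phi (inner Q P) /\ cancel (inner Q P) phi
      & forall x, phi x = inner P Q x.
  move=> PQ QP.
  have mm : monoid_morphism (inner P Q).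
    by split; [rewrite /inner mulr1 | apply: innerM].
  pose phi : {lrmorphism 'M[K[i]]_3 -> 'M[K[i]]_3} :=
    HB.pack (inner P Q) (GRing.isMonoidMorphism.Build _ _ _ mm).
  by exists phi => //; split; apply: innerK.
have [[P [Q [PQ QP RE]]]|[P [Q [PQ QP RE]]]] := conj_to_O_or_tr R_RB R1_neq0;
  have [phi [phiK phi'K] phiE] := aut P Q PQ QP;
  exists phi, (inner Q P), 1; split; rewrite ?oner_eq0 //; [left | right] => x.
  by rewrite scale1r /conjugate phiE -RE.
by rewrite scale1r /conjugate phiE -RE /= !trmxK.
Qed.
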